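(* Let $b \ge 2$ be an integer. (a) The positive integers with one or two base-$b$ digits that have two comma-children in base $b$ are precisely the numbers $w\cdot b + x$ with $0 \le w \le b-3$, $1 \le x \le \left\lfloor \frac{b-1}{2}\right\rfloor$ and $w = b-1-2x$. (b) The positive integers with three or more base-$b$ digits that have two comma-children in base $b$ are precisely the numbers whose base-$b$ representation is $$d\,(b-1)\,(b-1)\,\ldots\,(b-1)\,d\,(b-1-d),$$ that is, the digit $d$, followed by $i \ge 0$ digits equal to $b-1$, followed by the digit $d$, followed by the digit $b-1-d$, where $1 \le d \le b-2$.
   Context: Fix a base $b \ge 2$. A digit is any integer between $0$ and $b-1$. For a positive integer $n$, let $\delta(n)$ denote its leading (most significant, nonzero) base-$b$ digit. For positive integers $k, k'$, we say that $k'$ is a comma-child of $k$ (in base $b$) if $k' - k = d\cdot b + \delta(k')$, where $d = k \bmod b$ is the last base-$b$ digit of $k$. (A positive integer has at most two comma-children.) *)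

(* Defs.v *)
From mathcomp Require Import all_boot.
Set Implicit Arguments.
Unset Strict Implicit.
Unset Printing Implicit Defensive.

(* Most significant digit first; for b > 1 and n > 0, [trunc_log b n] is the
   exponent of the leading digit, so there is no leading zero. *)
Definition digits (b n : nat) : seq nat :=
  [seq (n %/ b ^ i) %% b | i <- rev (iota 0 (trunc_log b n).+1)].

Definition lead_digit (b n : nat) : nat := head 0 (digits b n).

(* k' - k = d * b + lead_digit b k', written additively because [-] on [nat]
   is truncated. *)
Definition comma_child (b k k' : nat) : Prop :=
  0 < k' /\ k' = k + ((k %% b) * b + lead_digit b k').

Definition two_comma_children (b k : nat) : Prop :=
  exists k1 k2 : nat, k1 <> k2 /\
    forall k', comma_child b k k' <-> k' = k1 \/ k' = k2.

(* Main.v *)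
Require Import Defs.
From mathcomp Require Import all_boot.
From mathcomp Require Import zify.

(** With x = k mod b, the comma-children of k are the K + e, for K = k + x b,
    such that e is the leading digit of K + e. Two of them are fewer than b
    apart, so the larger must be exactly e b^p, with the other right before it.
    Reducing K + e = e b^p modulo b gives x = b - e, so that k is determined by
    e and p: p = 1 yields (a), and p = i + 2 with d = e - 1 yields (b). *)

Lemma size_digits b n : size (digits b n) = (trunc_log b n).+1.
Proof. by rewrite size_map size_rev size_iota. Qed.

Lemma ltn_size_digits b n m : 1 < b -> 0 < m ->
  (m < size (digits b n)) = (b ^ m <= n).
Proof.
move=> b1 m0; rewrite size_digits ltnS; apply/idP/idP => [mt|]; last first.
  exact: trunc_log_max.
have n0 : 0 < n by case: n mt => //; rewrite trunc_log0 leqNgt m0.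
by apply: leq_trans (trunc_logP b1 n0); rewrite leq_exp2l.
Qed.

Lemma digits_small b n : n < b -> digits b n = [:: n].
Proof.
move=> nb; rewrite /digits.
have -> : trunc_log b n = 0.
  by apply/eqP; rewrite trunc_log_eq0; lia.
by rewrite /= expn0 divn1 modn_small.
Qed.

Lemma digits_rcons b n c : 1 < b -> 0 < n -> c < b ->
  digits b (n * b + c) = rcons (digits b n) c.
Proof.
move=> b1 n0 cb; have b0 : 0 < b by exact: ltnW.
have [lo hi] := andP (trunc_log_bounds b1 n0).
have -> : digits b (n * b + c)
  = [seq (n * b + c) %/ b ^ i %% b | i <- rev (iota 0 (trunc_log b n).+2)].
  rewrite /digits (_ : trunc_log b (n * b + c) = (trunc_log b n).+1) //.
  apply: trunc_log_eq => //; rewrite expnSr [b ^ _.+2]expnSr; apply/andP; split.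
    by rewrite (leq_trans _ (leq_addr _ _)) // leq_mul2r lo orbT.
  have : n.+1 * b <= b ^ (trunc_log b n).+1 * b by rewrite leq_mul2r hi orbT.
  by rewrite mulSn; lia.
rewrite -[iota 0 _.+2]/(0 :: iota (1 + 0) _.+1) iotaDl rev_cons map_rcons; congr rcons; last first.
  by rewrite expn0 divn1 modnMDl modn_small.
rewrite -map_rev -map_comp; apply: eq_map => i /=.
by rewrite add1n expnS divnMA divnMDl // (divn_small cb) addn0.
Qed.

(** Horner evaluation is a left inverse of [digits], hence its injectivity, which recovers [k] from
    the digit string in (b). *)
Lemma foldl_digits b n : 1 < b -> foldl (fun a c => a * b + c) 0 (digits b n) = n.
Proof.
move=> b1; have b0 : 0 < b by exact: ltnW.
elim/ltn_ind: n => n IH.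
have [nb|bn] := ltnP n b; first by rewrite digits_small.
have q0 : 0 < n %/ b by rewrite divn_gt0.
rewrite {1}(divn_eq n b) digits_rcons ?ltn_mod // foldl_rcons IH -?divn_eq //.
by rewrite ltn_Pdiv // (leq_trans b0).
Qed.

Lemma digits_inj b : 1 < b -> injective (digits b).
Proof. by move=> b1 m n e; rewrite -(foldl_digits _ m b1) e foldl_digits. Qed.

Lemma digits_max_tail b d i : 0 < d < b ->
  digits b (d.+1 * b ^ i - 1) = d :: nseq i (b - 1).
Proof.
case/andP=> d0 db; have b1 : 1 < b by lia.
elim: i => [|i IH]; first by rewrite expn0 muln1 subn1 digits_small.
have bi : 0 < b ^ i by rewrite expn_gt0 ltnW.
have -> : d.+1 * b ^ i.+1 - 1 = (d.+1 * b ^ i - 1) * b + (b - 1).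
  by rewrite expnSr mulnA mulnBl mul1n; nia.
rewrite digits_rcons ?IH; try nia.
by rewrite rcons_cons -[i.+1]addn1 nseqD cats1.
Qed.

(** The exponent [p] is left free so that two numbers can be compared by their exponents;
    [0 < e < b] forces it to be [trunc_log b n]. *)
Lemma lead_digitP b n e : 1 < b -> 0 < n ->
  lead_digit b n = e <-> 0 < e < b /\ exists p, e * b ^ p <= n < e.+1 * b ^ p.
Proof.
move=> b1 n0.
have [lo hi] := andP (trunc_log_bounds b1 n0).
have bp p : 0 < b ^ p by rewrite expn_gt0 ltnW.
have qb : n %/ b ^ trunc_log b n < b by rewrite ltn_divLR // -expnS.
have -> : lead_digit b n = n %/ b ^ trunc_log b n.
  by rewrite /lead_digit /digits -addn1 iotaD rev_cat /= add0n modn_small.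
split=> [<-|[/andP[e0 eb] [p /andP[elo ehi]]]].
  split; first by rewrite divn_gt0 // lo.
  by exists (trunc_log b n); rewrite leq_divM ltn_ceil.
have -> : trunc_log b n = p.
  apply: trunc_log_eq => //; rewrite expnS; apply/andP; split.
    by apply: leq_trans elo; rewrite leq_pmull.
  by apply: leq_trans ehi _; rewrite leq_mul2r eb orbT.
by apply/eqP; rewrite eqn_leq -ltnS ltn_divLR // ehi leq_divRL.
Qed.

(* If the leading digit changes from [e1] to [e2] within fewer than [b] steps,
   the jump has to cross [e2 * b ^ p], and this forces [e2 = e1 + 1]. *)
Lemma lead_digit_jump b K e1 e2 : 1 < b -> 0 < K -> e1 < e2 ->
  lead_digit b (K + e1) = e1 -> lead_digit b (K + e2) = e2 ->
  e2 = e1.+1 /\ exists2 p, 0 < p & K + e2 = e2 * b ^ p.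
Proof.
move=> b1 K0 e12.
case/lead_digitP=> [||/andP[e10 e1b] [p /andP[lo1 hi1]]]; rewrite ?addn_gt0 ?K0 //.
case/lead_digitP=> [||/andP[e20 e2b] [q /andP[lo2 hi2]]]; rewrite ?addn_gt0 ?K0 //.
have bp : 0 < b ^ p by rewrite expn_gt0 ltnW.
have p0 : 0 < p.
  by case: p {lo1 bp} hi1 => //; rewrite expn0; lia.
have bbp : b <= b ^ p by rewrite -{1}(expn1 b) leq_exp2l.
(* If [p < q], then [K + e1 < e2 * b ^ p] but [K + e2 >= e2 * b * b ^ p], a gap larger than [e2]. *)
have le_qp : q <= p.
  rewrite leqNgt; apply/negP => pq.
  have : b * b ^ p <= b ^ q by rewrite -expnS leq_exp2l.
  nia.
(* If [q < p], then [K + e2 < b * b ^ q <= b ^ p <= K + e1]. *)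
have le_pq : p <= q.
  rewrite leqNgt; apply/negP => qp.
  have : b * b ^ q <= b ^ p by rewrite -expnS leq_exp2l.
  nia.
have {le_qp le_pq} e : q = p by apply/eqP; rewrite eqn_leq le_qp.
rewrite {q}e in lo2 hi2.
have ee : e2 = e1.+1 by nia.
by split=> //; exists p => //; subst e2; lia.
Qed.

Lemma comma_childP b k k' : 1 < b -> 0 < k ->
  comma_child b k k' <->
  exists2 e, k' = k + k %% b * b + e & lead_digit b (k + k %% b * b + e) = e.
Proof.
move=> b1 k0; rewrite /comma_child; split=> [[_ kE]|[e kE le]].
  by exists (lead_digit b k'); rewrite -addnA -kE.
by rewrite kE le; split; lia.
Qed.

Lemma two_comma_childrenE b k : 1 < b -> 0 < k ->
  two_comma_children b k <->
  exists e p, [/\ 1 < e < b, 0 < p & k + (b - e) * b + e = e * b ^ p].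
Proof.
move=> b1 k0; split=> [[k1 [k2 [k12 kids]]]|[e [p [/andP[e1 eb] p0 kE]]]].
  set K := k + k %% b * b.
  have K0 : 0 < K by rewrite /K; lia.
  have [e1 [e2 [lt l1 l2]]] : exists e1 e2,
      [/\ e1 < e2, lead_digit b (K + e1) = e1 & lead_digit b (K + e2) = e2].
    have [f1 kf1 lf1] : exists2 e, k1 = K + e & lead_digit b (K + e) = e.
      by apply/comma_childP => //; apply/kids; left.
    have [f2 kf2 lf2] : exists2 e, k2 = K + e & lead_digit b (K + e) = e.
      by apply/comma_childP => //; apply/kids; right.
    case: (ltngtP f1 f2) => [f12|f21|fE]; [by exists f1, f2|by exists f2, f1|].
    by case: k12; rewrite kf1 kf2 fE.
  have [/andP[e10 _] _] := (lead_digitP _ _ _ b1 (ltn_addr e1 K0)).1 l1.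
  have [/andP[_ e2b] _] := (lead_digitP _ _ _ b1 (ltn_addr e2 K0)).1 l2.
  have [_ [p p0 KE]] := lead_digit_jump _ _ _ _ b1 K0 lt l1 l2.
  exists e2, p; split=> //; first by rewrite e2b andbT; lia.
  suff -> : b - e2 = k %% b by [].
  have xb : k %% b < b by rewrite ltn_mod; lia.
  have /dvdnP[m mE] : b %| k %% b + e2.
    rewrite -(dvdn_addr (m := (k %/ b + k %% b) * b)) ?dvdn_mull //.
    rewrite (_ : _ + _ = e2 * b ^ p); last by rewrite -KE /K; move: (k %/ b) (k %% b) (divn_eq k b) => q x ->; lia.
    by rewrite dvdn_mull // dvdn_exp.
  (* The sum [k %% b + e2] lies strictly between 0 and [2 * b]. *)
  have m1 : m = 1 by nia.
  by lia.
have bbp : b <= b ^ p by rewrite -{1}(expn1 b) leq_exp2l.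
(* Adding [b.+1 * b] leaves the residue of [k] unchanged and makes the right-hand side visibly
   congruent to [b - e], without truncated subtraction. *)
have xE : k %% b = b - e.
  have {}kE : k + b.+1 * b = (e * b ^ p.-1 + e) * b + (b - e).
    by rewrite mulnDl -mulnA -expnSr prednK //; nia.
  by rewrite -(modnMDl b.+1) addnC kE modnMDl modn_small; lia.
set K := k + k %% b * b.
have KE : K + e = e * b ^ p by rewrite /K xE.
have K0 : 0 < K by rewrite /K; lia.
have kid2 : lead_digit b (K + e) = e.
  apply/lead_digitP => //; [lia|split; first lia].
  by exists p; rewrite KE leqnn ltn_mul2r ltnSn andbT; lia.
have kid1 : lead_digit b (K + e.-1) = e.-1.
  apply/lead_digitP => //; [lia|split; first lia].
  exists p; have : e.-1 * b ^ p + b ^ p = e * b ^ p by rewrite -mulSnr prednK //; lia.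
  by rewrite prednK; lia.
exists (K + e.-1), (K + e); split=> [|k']; first lia.
rewrite comma_childP //; split=> [[f -> lf]|[->|->]]; first last.
- by exists e.
- by exists e.-1.
(* No third child: a jump from [f] up to [e] gives [f = e.-1], while [f > e] would have to be the
   successor of both [e] and [e.-1]. *)
have [fe|ef|->] := ltngtP f e; last by right.
- by have [-> _] := lead_digit_jump _ _ _ _ b1 K0 fe lf kid2; left.
have [fE1 _] := lead_digit_jump _ _ _ _ b1 K0 ef kid2 lf.
have lt : e.-1 < f by lia.
have [fE2 _] := lead_digit_jump _ _ _ _ b1 K0 lt kid1 lf.
by lia.
Qed.

(** Exponent 1 gives [k < e * b < b ^ 2]. From exponent 2 on, the right-hand side is at least
    [2 * b ^ 2], and at most [b ^ 2] is subtracted from it to get [k]. *)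
Lemma two_comma_children_size b k e p : 1 < b -> 1 < e < b ->
  k + (b - e) * b + e = e * b ^ p.+1 -> (2 < size (digits b k)) = (0 < p).
Proof.
move=> b1 eb kE; rewrite ltn_size_digits // -mulnn.
case: p kE => [|p]; first by rewrite expn1 => kE; nia.
have bp : 0 < b ^ p by rewrite expn_gt0 ltnW.
case/andP: eb => e1 eb; rewrite ltn0Sn => kE.
have lbe : 2 * (b * b) <= e * b ^ p.+2.
  by rewrite !expnS [b * (b * _)]mulnA leq_mul // leq_pmulr.
have ubx : (b - e) * b + e <= b * b by rewrite mulnBl; nia.
by lia.
Qed.

(* With w + 3 <= b for w <= b - 3, the remaining natural-number subtractions
   never truncate: 2 * x <= b - 1 in (a), and d <= b - 2 in (b). *)
Theorem theorem5p2 (b : nat) (hb : 2 <= b) :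
  (forall k : nat,
     [/\ 0 < k, size (digits b k) <= 2 & two_comma_children b k] <->
     exists w x : nat,
       [/\ w + 3 <= b, 1 <= x <= (b - 1) %/ 2, w = b - 1 - 2 * x
         & k = w * b + x])
  /\
  (forall k : nat,
     [/\ 0 < k, 3 <= size (digits b k) & two_comma_children b k] <->
     exists d i : nat,
       1 <= d <= b - 2 /\
       digits b k = d :: nseq i (b - 1) ++ [:: d; b - 1 - d]).
Proof.
split=> k.
  split=> [[k0 sz /two_comma_childrenE[//|//|e [[|p] [eb // _ kE]]]]|].
    have := two_comma_children_size _ _ _ _ hb eb kE.
    rewrite ltnNge sz /=; case: p kE => // kE _.
    case/andP: eb => e1 eb; rewrite expn1 in kE.
    (* Here [k = (2 * e - b) * b - e], so [2 * e > b]; borrowing one [b] leaves the last digit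
       [b - e] and the quotient [2 * e - b - 1]. *)
    exists (b - 1 - 2 * (b - e)), (b - e).
    have xe : 2 * (b - e) <= b - 1 by nia.
    by split=> //; [lia|lia|nia].
  case=> w [x [wb xb -> ->]].
  have [x0 xle] : 0 < x /\ 2 * x <= b - 1.
    case/andP: xb => x0; by rewrite leq_divRL // mulnC.
  have k0 : 0 < (b - 1 - 2 * x) * b + x by rewrite ltn_addl.
  have eb : 1 < b - x < b by lia.
  have kE : (b - 1 - 2 * x) * b + x + (b - (b - x)) * b + (b - x) = (b - x) * b ^ 1.
    by rewrite expn1; nia.
  split=> //; last by apply/two_comma_childrenE => //; exists (b - x), 1.
  by rewrite leqNgt (two_comma_children_size _ _ _ _ hb eb kE).
(* The prefix [d :: nseq i (b - 1)] has value [d.+1 * b ^ i - 1]; the last two digits are then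
   appended. *)
have digE d i : 1 <= d <= b - 2 ->
    digits b (((d.+1 * b ^ i - 1) * b + d) * b + (b - 1 - d))
    = d :: nseq i (b - 1) ++ [:: d; b - 1 - d].
  move=> db; have bi : 0 < b ^ i by rewrite expn_gt0 ltnW.
  rewrite !digits_rcons ?digits_max_tail; try nia.
  by rewrite !rcons_cons -!cats1 -catA.
(* This number solves the equation of [two_comma_childrenE] for [e = d.+1] and [p = i.+2]. *)
have valE d i : 1 <= d <= b - 2 ->
    ((d.+1 * b ^ i - 1) * b + d) * b + (b - 1 - d) + (b - d.+1) * b + d.+1
    = d.+1 * b ^ i.+2.
  move=> db; have bi : 0 < b ^ i by rewrite expn_gt0 ltnW.
  by rewrite !expnS; nia.
split=> [[k0 sz /two_comma_childrenE[//|//|e [[|p] [eb // _ kE]]]]|].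
  have := two_comma_children_size _ _ _ _ hb eb kE.
  rewrite sz; case: p kE => // i kE _.
  have db : 1 <= e.-1 <= b - 2 by lia.
  exists e.-1, i; split=> //; rewrite -digE //; congr digits.
  by have := valE _ i db; rewrite prednK; lia.
(* The length [i + 3] is saved in [sz] before [kE] is turned into an equation between numbers. *)
case=> d [i [db kE]]; have sz := congr1 size kE; rewrite -digE // in kE.
move/(digits_inj _ hb): kE => kE.
have k0 : 0 < k by rewrite kE ltn_addl; lia.
rewrite sz /= size_cat size_nseq /= addn2; split=> //.
apply/two_comma_childrenE => //; exists d.+1, i.+2; split=> //; first lia.
by rewrite kE valE.
Qed.
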